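(* For every numerical semigroup $S\ne\mathbb{N}$, $$c(S)\;\le\;\bigl(t(S)+1\bigr)n(S)-\sigma(S)\;\le\;\bigl(t(S)+1\bigr)n(S).$$ Equality holds in the first inequality if and only if $\Theta(S)=0$, and in the second if and only if $\sigma(S)=0$. In particular, $t(S)\le e(S)-1$ implies $c(S)\le e(S)\,n(S)$.
   Context: $\mathbb{N}=\{0,1,2,\dots\}$. A numerical semigroup is a submonoid $S\subseteq\mathbb{N}$ (under addition) with finite complement $G(S)=\mathbb{N}\setminus S$, whose elements are the gaps. Let $S\ne\mathbb{N}$. $F=\max G(S)$, $c(S)=F+1$, $n(S)=|S\cap[0,c(S))|$, and $e(S)$ is the cardinality of the unique minimal system of generators of $S$. An integer $f$ is a pseudo-Frobenius number if $f\notin S$ and $f+s\in S$ for all $s\in S\setminus\{0\}$; $\mathrm{PF}(S)$ is the set of these and $t(S)=|\mathrm{PF}(S)|$. For an integer $x\in[1,F]$, $\nu_S(x)=|\{f\in\mathrm{PF}(S): f-x\in S\}|$. Define $$\sigma(S)=\sum_{f\in\mathrm{PF}(S)}|S\cap(f,F]|,\qquad \Theta(S)=\sum_{x\in G(S)}(\nu_S(x)-1).$$ *)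

(* Defs.v *)
From mathcomp Require Import all_boot all_order all_algebra.
From mathcomp Require Import finmap all_classical.

Set Implicit Arguments.
Unset Strict Implicit.
Unset Printing Implicit Defensive.

Import Order.TTheory GRing.Theory Num.Theory.

Local Open Scope classical_set_scope.
Local Open Scope ring_scope.

Definition submonoid (S : set nat) : Prop :=
  S 0%N /\ forall a b : nat, S a -> S b -> S (a + b)%N.

Definition gaps (S : set nat) : set nat := ~` S.

Definition numerical_semigroup (S : set nat) : Prop :=
  submonoid S /\ finite_set (gaps S).

(* Cardinality of a finite set; the value is 0 on infinite sets. *)
Definition card (T : choiceType) (A : set T) : nat := #|` fset_set A|.

(* F, defined as the maximum of G(S); the value is 0 if there are no gaps. *)
Definition frobenius (S : set nat) : nat := (\max_(x <- fset_set (gaps S)) x)%N.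

Definition conductor (S : set nat) : nat := (frobenius S + 1)%N.

Definition n_left (S : set nat) : nat := card (S `&` `I_(conductor S)).

Definition generates (A S : set nat) : Prop := smallest submonoid A = S.

Definition minimal_generators (S A : set nat) : Prop :=
  generates A S /\ forall B : set nat, B `<=` A -> generates B S -> B = A.

(* The default [set0] of [xget] is irrelevant: a numerical semigroup has exactly
   one minimal system of generators. *)
Definition embdim (S : set nat) : nat :=
  card (xget set0 [set A | minimal_generators S A]).

(* S as a set of integers, so that the differences f - x below are
   genuine (untruncated) ones. *)
Definition intset (S : set nat) : set int := Posz @` S.

Definition PF (S : set nat) : set int :=
  [set f : int | ~ intset S f /\
    forall s : int, intset S s -> s <> 0 -> intset S (f + s)].

Definition pf_type (S : set nat) : nat := card (PF S).

Definition nu (S : set nat) (x : int) : nat :=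
  card [set f : int | PF S f /\ intset S (f - x)].

Definition sigma (S : set nat) : int :=
  \sum_(f \in PF S)
    (card (intset S `&` [set x : int | f < x <= (frobenius S)%:Z]))%:Z.

Definition Theta (S : set nat) : int :=
  \sum_(x \in gaps S) ((nu S x%:Z)%:Z - 1).

(* Main.v *)
Require Import Defs.
From mathcomp Require Import all_boot all_order all_algebra.
From mathcomp Require Import finmap all_classical.
From mathcomp Require Import zify.

(** Count the pairs [(f, x)] with [f] pseudo-Frobenius, [x] a gap and [f - x]
    in [S].  For fixed [x] there are [nu S x >= 1] of them, since adding nonzero
    elements of [S] to [x] while staying among the gaps ends at a
    pseudo-Frobenius number.  For fixed [f] the map [x |-> f - x] is a bijection
    onto the elements of [S] below [f], because [f - s] with [s] in [S] is
    always a gap; there are [n - |S `&` (f, F]|] of them.  As there are [c - n]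
    gaps, double counting gives [Theta = (t + 1) n - sigma - c]. *)

Import Order.TTheory GRing.Theory Num.Theory.

Local Open Scope classical_set_scope.
Local Open Scope ring_scope.

Local Notation card := Defs.card.

Lemma card_setU_disjoint (T : choiceType) (A B : set T) :
  finite_set A -> finite_set B -> A `&` B = set0 ->
  card (A `|` B) = (card A + card B)%N.
Proof.
move=> finA finB AB0.
by rewrite /card fset_setU// cardfsU -fset_setI// AB0 fset_set0 cardfs0 subn0.
Qed.

Lemma card_image_inj {T U : choiceType} {f : T -> U} {A : set T} :
  injective f -> finite_set A -> card (f @` A) = card A.
Proof. by move=> injf finA; rewrite /card fset_set_image// card_imfset. Qed.

(** Cardinals become sums of 0/1 indicators, so that double counting reduces to exchanging two
    sums. *)
Lemma card_setI_sum (T : choiceType) (A P : set T) :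
  finite_set A ->
  card (A `&` P) = (\sum_(x <- fset_set A) `[< P x >])%N.
Proof.
move=> finA; rewrite /card.
have -> : (\sum_(x <- fset_set A) `[< P x >] =
           \sum_(x <- fset_set A | `[< P x >]) 1)%N.
  by rewrite [RHS]big_mkcond; apply: eq_bigr => x _; case: asboolP.
rewrite sum1_count -size_filter; apply/perm_size/uniq_perm => [||x].
- exact: fset_uniq.
- exact/filter_uniq/fset_uniq.
rewrite mem_filter !in_fset_set//; last exact: finite_setIl.
by rewrite in_setI andbC; congr (_ && _); rewrite inE.
Qed.

Section NumericalSemigroup.
Variable S : set nat.
Hypothesis hS : numerical_semigroup S.

Let S0 : S 0%N. Proof. by case: hS => -[]. Qed.
Let SD a b : S a -> S b -> S (a + b)%N. Proof. by case: hS => -[_ SD] _; exact: SD. Qed.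
Let fin_gaps : finite_set (gaps S). Proof. by case: hS. Qed.

Lemma gap_le_frobenius {x} : ~ S x -> (x <= frobenius S)%N.
Proof.
move=> Sx; rewrite /frobenius.
by apply: (@leq_bigmax_seq _ _ _ id) => //; rewrite in_fset_set// inE.
Qed.

Lemma intset_nat (a : nat) : intset S a%:Z <-> S a.
Proof. by split => [[b Sb []] <-//|Sa]; exists a. Qed.

(** No gap exceeds [frobenius S], so the gaps and the elements of [S] below the conductor partition
    [[0, c)]. *)
Lemma conductor_gaps : conductor S = (card (gaps S) + n_left S)%N.
Proof.
have cardI m : card `I_m = m by exact: card_fset_set.
rewrite /n_left -card_setU_disjoint //.
- rewrite -[LHS]cardI; congr card; apply/seteqP; split => [x /= xc|x [Sx|[]//]].
    by have [Sx|Sx] := pselect (S x); [right|left].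
  by rewrite /= /conductor addn1 ltnS; exact: gap_le_frobenius.
- exact: finite_setIr.
- by rewrite -subset0 => x [Sx [Sx' _]].
Qed.

(** Excludes negative integers from [PF S]; for [S = setT] the number -1 would qualify. *)
Lemma PF_nat {f : int} : S <> setT -> PF S f ->
  exists2 g : nat, f = g%:Z & ~ S g.
Proof.
move=> SN [Sf PFf]; case: f => [g|k] in Sf PFf *.
  by exists g => // Sg; apply: Sf; exists g.
case: SN; apply/seteqP; split => // x _.
have large y : (frobenius S < y)%N -> S y.
  by move=> Fy; apply: contrapT => /gap_le_frobenius; lia.
(* Were [-(k+1)] pseudo-Frobenius, membership of all large numbers would descend
   down to 0. *)
suff desc m y : (frobenius S < m + y)%N -> S y.
  by apply: (desc (frobenius S).+1); lia.
elim: m y => [y|m IHm y mF]; first exact: large.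
have Syk : S (y + k.+1)%N by apply: IHm; lia.
have /PFf : intset S (y + k.+1)%:Z by apply/intset_nat.
have -> : Negz k + (y + k.+1)%:Z = y%:Z by lia.
by move=> h; apply/intset_nat; apply: h; lia.
Qed.

Lemma finite_PF : S <> setT -> finite_set (PF S).
Proof.
move=> SN; apply: (@sub_finite_set _ _ (Posz @` gaps S)).
  by move=> f /(PF_nat SN)[g -> Sg]; exists g.
exact: finite_image.
Qed.

Lemma PF_above_gap {x : nat} : ~ S x -> exists2 s, S s & PF S (x + s)%:Z.
Proof.
have [k] := ubnP (frobenius S - x)%N; elim: k x => // k IHk x xk Sx.
have [PFx|nPFx] := pselect (PF S x%:Z); first by exists 0%N; rewrite ?addn0.
have [s [Ss s0 Sxs]] : exists s, [/\ S s, s <> 0%N & ~ S (x + s)%N].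
  apply: contrapT => noS; apply: nPFx; split; first by move/intset_nat.
  move=> _ [s Ss <-] s0; apply: contrapT => Sxs; apply: noS; exists s.
  split => // [s00|Sxs']; first by apply: s0; rewrite s00.
  by apply: Sxs; rewrite -PoszD; exists (x + s)%N.
have [|u Su PFu] := IHk (x + s)%N _ Sxs.
  by have := gap_le_frobenius Sxs; lia.
by exists (s + u)%N; [exact: SD|rewrite addnA].
Qed.

Lemma nu_sum (x : int) : S <> setT ->
  nu S x = (\sum_(f <- fset_set (PF S)) `[< intset S (f - x)%R >])%N.
Proof. by move=> SN; rewrite -card_setI_sum//; exact: finite_PF. Qed.

Lemma nu_gt0 (x : nat) : S <> setT -> ~ S x -> (0 < nu S x%:Z)%N.
Proof.
move=> SN /PF_above_gap[s Ss PFs]; rewrite /nu /card cardfs_gt0.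
apply/fset0Pn; exists (x + s)%:Z; rewrite in_fset_set; last first.
  (* Finiteness matters here: [card] is 0 on infinite sets. *)
  by apply: sub_finite_set (finite_PF SN) => f [].
rewrite inE; split => //; rewrite PoszD addrC addKr.
by exists s.
Qed.

Lemma n_left_split (f : int) : S <> setT -> PF S f ->
  n_left S =
  ((\sum_(x <- fset_set (gaps S)) `[< intset S (f - x%:Z)%R >]) +
   card (intset S `&` [set x : int | (f < x <= (frobenius S)%:Z)%R]))%N.
Proof.
move=> SN PFf; have [g fg Sg] := PF_nat SN PFf; rewrite fg in PFf *.
have gF := gap_le_frobenius Sg.
rewrite -(card_setI_sum _ _ [set x : nat | intset S (g%:Z - x%:Z)])//.
have injB : injective (fun x : nat => g%:Z - x%:Z) by move=> x y; lia.
have injP : injective Posz by move=> x y [].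
have finI : finite_set (S `&` `I_(conductor S)) by exact: finite_setIr.
rewrite /n_left -(card_image_inj injP finI).
rewrite -(card_image_inj injB); last exact: finite_setIl.
rewrite -card_setU_disjoint.
- congr card; apply/seteqP; split => [_ [s [Ss /= sc] <-]|].
    rewrite /conductor in sc.
    have [gs|sg] := ltnP g s; [right|left].
      by split; [exists s|rewrite /=; lia].
    exists (g - s)%N; last by lia.
    split; last by exists s => //; lia.
    by move=> Sgs; apply: Sg; rewrite -(subnK sg); exact: SD.
  move=> _ [[x [Sx [s Ss sE]] <-]|[[s Ss <-] /= sF]].
    exists s; last by [].
    by split => //=; rewrite /conductor; lia.
  by exists s => //; split => //=; rewrite /conductor; lia.
- exact/finite_image/finite_setIl.
- apply: (@sub_finite_set _ _ (Posz @` `I_(conductor S))).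
    by move=> _ [[s Ss <-] /= sF]; exists s => //=; rewrite /conductor; lia.
  exact/finite_image.
- rewrite -subset0 => _ [[x _ <-] [_ /=]]; lia.
Qed.

Lemma sum_nu : S <> setT ->
  (\sum_(x <- fset_set (gaps S)) nu S x%:Z)%N%:Z =
  (pf_type S)%:Z * (n_left S)%:Z - sigma S.
Proof.
move=> SN; have finPF := finite_PF SN.
rewrite /sigma fsbig_finite//= -(big_morph Posz PoszD (erefl _)).
apply/eqP; rewrite eq_sym subr_eq -PoszM -PoszD; apply/eqP; congr Posz.
rewrite (eq_bigr _ (fun x _ => nu_sum x%:Z SN)) exchange_big -big_split /=.
rewrite /pf_type /card -sum1_size big_distrl /=.
apply: eq_big_seq => f; rewrite in_fset_set// inE => PFf.
by rewrite mul1n; exact: n_left_split.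
Qed.

Lemma ThetaE : S <> setT ->
  Theta S = ((pf_type S)%:Z + 1) * (n_left S)%:Z - sigma S - (conductor S)%:Z.
Proof.
move=> SN; rewrite /Theta fsbig_finite//= big_split /= sumrN.
rewrite -!(big_morph Posz PoszD (erefl _)) sum_nu// sum1_size conductor_gaps.
by rewrite -/(card (gaps S)) PoszD mulrDl mul1r; lia.
Qed.

Lemma Theta_ge0 : S <> setT -> 0 <= Theta S.
Proof.
move=> SN; rewrite /Theta fsbig_finite//= big_seq sumr_ge0// => x.
by rewrite in_fset_set// inE => /(nu_gt0 _ SN); rewrite subr_ge0.
Qed.

Lemma sigma_ge0 : S <> setT -> 0 <= sigma S.
Proof.
move=> SN; rewrite /sigma fsbig_finite; last exact: finite_PF.
exact: sumr_ge0.
Qed.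

End NumericalSemigroup.

Theorem corollary3p3 (S : set nat) (hS : numerical_semigroup S)
    (hSN : S <> setT) :
  let c : int := (conductor S)%:Z in
  let n : int := (n_left S)%:Z in
  let t : int := (pf_type S)%:Z in
  let e : int := (embdim S)%:Z in
  (c <= (t + 1) * n - sigma S /\ (t + 1) * n - sigma S <= (t + 1) * n) /\
  (c = (t + 1) * n - sigma S <-> Theta S = 0) /\
  ((t + 1) * n - sigma S = (t + 1) * n <-> sigma S = 0) /\
  (t <= e - 1 -> c <= e * n).
Proof.
move=> c n t e; rewrite /c /n /t /e {c n t e}.
have := Theta_ge0 _ hS hSN; have := sigma_ge0 _ hS hSN.
rewrite (ThetaE _ hS hSN); move: (sigma S) => s s0 h.
split; [by split; lia|split; [by split; lia|split; [by split; lia|move=> te]]].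
apply: (@le_trans _ _ (((pf_type S)%:Z + 1) * (n_left S)%:Z)); first by lia.
by rewrite ler_wpM2r//; lia.
Qed.
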